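(* Let $q\ge 1$ be an integer and let $G$ be a simple connected graph with $n\ge 2$ nodes and $m$ edges. Let $1=\lambda_1>\lambda_2\geq\cdots\geq\lambda_n\geq-1$ be the eigenvalues of the normalized adjacency matrix $P$ of $G$, and let $v_1,v_2,\ldots,v_n$ be corresponding orthonormal eigenvectors, $v_i=(v_{i1},\ldots,v_{in})^\top$. Let $C=(B\;B\;\cdots\;B)$ be the $n\times mq$ matrix consisting of $q$ copies of the incidence matrix $B$ of $G$. Let $\hat P$ be the normalized adjacency matrix of $S_q(G)$. Then: (i) If $G$ is non-bipartite, then $\pm\sqrt{\frac{1+\lambda_i}{2}}$, $i=1,2,\ldots,n$, are eigenvalues of $\hat{P}$ (listed with multiplicity), and the entry at node $j$ of the corresponding orthonormal eigenvectors is $$\begin{cases}\frac{1}{\sqrt{2}}v_{ij}, & j\in V,\\[4pt] \pm\sqrt{\frac{1}{2q(1+\lambda_i)}}\left(\frac{v_{is}}{\sqrt{d_s}}+\frac{v_{it}}{\sqrt{d_t}}\right), & j\in V',\ \hat{\Gamma}(j)=\{s,t\},\end{cases}$$ with the sign $\pm$ matching that of the eigenvalue; moreover $0$ is an eigenvalue of $\hat{P}$ with multiplicity $mq-n$, with corresponding orthonormal eigenvectors $$\begin{pmatrix}0\\ Y_z\end{pmatrix},\quad z=1,2,\ldots,mq-n,$$ where $Y_1,\ldots,Y_{mq-n}$ is an orthonormal basis of the kernel of $C$. (ii) If $G$ is bipartite, then $\pm\sqrt{\frac{1+\lambda_i}{2}}$, $i=1,2,\ldots,n-1$, are eigenvalues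 of $\hat{P}$ (listed with multiplicity), and the entry at node $j$ of the corresponding orthonormal eigenvectors is $$\begin{cases}\frac{1}{\sqrt{2}}v_{ij}, & j\in V,\\[4pt] \pm\sqrt{\frac{1}{2q(1+\lambda_i)}}\left(\frac{v_{is}}{\sqrt{d_s}}+\frac{v_{it}}{\sqrt{d_t}}\right), & j\in V',\ \hat{\Gamma}(j)=\{s,t\},\end{cases}$$ with the sign $\pm$ matching that of the eigenvalue; moreover $0$ is an eigenvalue of $\hat{P}$ with multiplicity $mq-n+2$, with corresponding orthonormal eigenvectors $$\begin{pmatrix}v_n\\ 0\end{pmatrix},\quad \begin{pmatrix}0\\ Y_z\end{pmatrix},\quad z=1,2,\ldots,mq-n+1,$$ where $Y_1,\ldots,Y_{mq-n+1}$ is an orthonormal basis of the kernel of $C$.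
   Context: For a graph $G$ with node set $V=\{1,\ldots,n\}$ and edges $e_1,\ldots,e_m$, $A$ is the adjacency matrix, $d_i$ is the degree of node $i$, $D=\mathrm{diag}(d_1,\ldots,d_n)$, and $P=D^{-1/2}AD^{-1/2}$ is the normalized adjacency matrix. The incidence matrix $B$ is the $n\times m$ matrix with $B(i,j)=1$ if node $i$ is incident with $e_j$ and $0$ otherwise (unsigned). The $q$-subdivision graph $S_q(G)$ is obtained from $G$ by replacing each edge $uv$ with $q$ disjoint paths of length $2$: $ux_1v,\ldots,ux_qv$. Its node set is $V\cup V'$, where $V=V(G)$ is the set of old nodes and $V'$ is the set of $mq$ new nodes; $V'=V^{(1)}\cup\cdots\cup V^{(q)}$, where each $V^{(f)}$ contains exactly one new node for each edge of $G$. For $j\in V'$, $\hat\Gamma(j)$ denotes the set of neighbors of $j$ in $S_q(G)$, i.e. the two end nodes of the edge of $G$ that produced $j$. Quantities with a hat refer to $S_q(G)$: $\hat A$, $\hat D$ are its adjacency and degree matrices and $\hat P=\hat D^{-1/2}\hat A\hat D^{-1/2}$. Nodes of $S_q(G)$ are ordered as $V, V^{(1)},\ldots,V^{(q)}$, with each $V^{(f)}$ ordered as the edges $e_1,\ldots,e_m$; block vectors are with respect to the splitting $V\cup V'$ (first block of length $n$, second of length $mq$). *)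

(* Defs.v *)
From mathcomp Require Import all_boot all_order all_algebra.

Set Implicit Arguments.
Unset Strict Implicit.
Unset Printing Implicit Defensive.

Import GRing.Theory Num.Theory.
Local Open Scope ring_scope.

Record sgraph (n : nat) := SGraph {
  edge_rel :> rel 'I_n;
  edge_sym : symmetric edge_rel;
  edge_irr : irreflexive edge_rel }.

Definition connected n (G : sgraph n) : Prop := forall i j, connect G i j.

Definition bipartite n (G : sgraph n) : Prop :=
  exists c : 'I_n -> bool, forall i j, G i j -> c i != c j.

Definition deg n (G : sgraph n) (i : 'I_n) : nat := #|[set j | G i j]|.

Definition edges n (G : sgraph n) : {set {set 'I_n}} :=
  [set [set p.1; p.2] | p : 'I_n * 'I_n & G p.1 p.2].

(* [es] lists the edges e_1, ..., e_m of [G] once each, in an arbitrary order. *)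
Definition edge_enumeration n m (G : sgraph n) (es : m.-tuple {set 'I_n}) :=
  uniq es /\ es =i edges G.

Definition adj_mx (R : rcfType) n (G : sgraph n) : 'M[R]_n :=
  \matrix_(i, j) (G i j)%:R.

(* D^(-1/2) *)
Definition deg_invsqrt_mx (R : rcfType) n (G : sgraph n) : 'M[R]_n :=
  diag_mx (\row_i (Num.sqrt (deg G i)%:R)^-1).

Definition norm_adj_mx (R : rcfType) n (G : sgraph n) : 'M[R]_n :=
  deg_invsqrt_mx R G *m adj_mx R G *m deg_invsqrt_mx R G.

Definition incidence_mx (R : rcfType) n m (es : m.-tuple {set 'I_n}) :
    'M[R]_(n, m) :=
  \matrix_(i, k) (i \in tnth es k)%:R.

Lemma edge_index_subproof m q (j : 'I_(m * q)) : (j %% m < m)%N.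
Proof. by rewrite ltn_mod; case: m j => // -[]. Qed.

(* The new nodes are the j < m * q, in q consecutive blocks of size m: node     *)
(* j = f * m + k belongs to the f-th block and subdivides the k-th edge.        *)
Definition edge_index m q (j : 'I_(m * q)) : 'I_m :=
  Ordinal (edge_index_subproof j).

Definition copies_mx (R : rcfType) n m q (B : 'M[R]_(n, m)) :
    'M[R]_(n, m * q) :=
  \matrix_(i, j) B i (edge_index j).

Definition subdivision_rel n m (es : m.-tuple {set 'I_n}) q :
    rel 'I_(n + m * q) :=
  fun x y => match split x, split y with
             | inl u, inr j => u \in tnth es (edge_index j)
             | inr j, inl u => u \in tnth es (edge_index j)
             | _, _ => false
             end.

Lemma subdivision_sym n m (es : m.-tuple {set 'I_n}) q :
  symmetric (subdivision_rel es (q := q)).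
Proof.
by move=> x y; rewrite /subdivision_rel; case: (split x); case: (split y).
Qed.

Lemma subdivision_irr n m (es : m.-tuple {set 'I_n}) q :
  irreflexive (subdivision_rel es (q := q)).
Proof. by move=> x; rewrite /subdivision_rel; case: (split x). Qed.

(* S_q(G), for the graph G whose edges are listed by [es] *)
Definition subdivision n m (es : m.-tuple {set 'I_n}) q : sgraph (n + m * q) :=
  SGraph (@subdivision_sym n m es q) (@subdivision_irr n m es q).

Definition orthonormal (R : rcfType) (I : eqType) N (w : I -> 'cV[R]_N) : Prop :=
  forall x y, ((w x)^T *m w y) 0 0 = (x == y)%:R.

(* [mu] lists all the eigenvalues of [M] with multiplicity, and [w] is a family *)
(* of corresponding orthonormal eigenvectors.                                   *)
Definition orthonormal_eigensystem (R : rcfType) (I : finType) N (M : 'M[R]_N)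
    (mu : I -> R) (w : I -> 'cV[R]_N) : Prop :=
  [/\ char_poly M = \prod_x ('X - (mu x)%:P),
      forall x, M *m w x = mu x *: w x
    & orthonormal w].

Definition orthonormal_kernel_basis (R : rcfType) p N k (C : 'M[R]_(p, N))
    (Y : 'I_k -> 'cV[R]_N) : Prop :=
  orthonormal Y /\
  forall y : 'cV[R]_N,
    C *m y = 0 <-> exists a : 'I_k -> R, y = \sum_z a z *: Y z.

(* algebraic multiplicity *)
Definition eigen_mult (R : rcfType) N (M : 'M[R]_N) (a : R) : nat :=
  mup a (char_poly M).

(* Below, the sign is + for b = false and - for b = true. *)
Definition subdiv_eigval (R : rcfType) (l : R) (b : bool) : R :=
  (-1) ^+ b * Num.sqrt ((1 + l) / 2%:R).

(* The sum runs over the two neighbours s, t in S_q(G) of the new node j. *)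
Definition subdiv_eigvec (R : rcfType) n m q (G : sgraph n)
    (es : m.-tuple {set 'I_n}) (l : R) (u : 'cV[R]_n) (b : bool) :
    'cV[R]_(n + m * q) :=
  col_mx
    ((Num.sqrt 2%:R)^-1 *: u)
    (\col_j ((-1) ^+ b * Num.sqrt ((2%:R * q%:R * (1 + l))^-1) *
       \sum_(s | subdivision es q (rshift n j) (lshift (m * q) s))
          u s 0 / Num.sqrt (deg G s)%:R)).

(* Main.v *)
Require Import Defs.
From mathcomp Require Import all_boot all_order all_algebra.
From mathcomp Require Import ring zify.
(* [orthonormal] also names a notion of the theory of sesquilinear forms; the
   one meant below is the notion for families of column vectors. *)
Import Defs.

Set Implicit Arguments.
Unset Strict Implicit.
Unset Printing Implicit Defensive.

Import Order.TTheory GRing.Theory Num.Theory.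
Local Open Scope ring_scope.

(** The subdivision graph is bipartite between old and new nodes, so its
    normalized adjacency matrix has the form [[0, E], [E^T, 0]] with
    [E = (2q)^(-1/2) D^(-1/2) C] ([norm_adj_subdivision]). The spectrum of such
    a matrix is read off the singular value decomposition of [E]. Since
    [B B^T = D + A], it satisfies [E E^T = (1 + P) / 2]
    ([scaled_incidence_mul_tr]): the left singular vectors of [E] are the
    eigenvectors [v_i] of [P], with singular values
    [sqrt ((1 + lambda_i) / 2)].

    Every nonzero singular value [s] with left vector [u] contributes the
    eigenvalues [s] and [-s], with eigenvectors [u / sqrt 2] on top of a
    multiple of [E^T u]; the vectors [(0, y)] with [C y = 0], and [(u, 0)]
    with [E^T u = 0], are null vectors. Once these vectors are seen to be
    orthonormal and to number [n + m q], they form an eigenbasis, which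
    determines the characteristic polynomial and so all the multiplicities
    ([dilation_eigensystem], [char_poly_orthonormal]).

    What remains is to know which singular values vanish, that is the left
    kernel of [C]. A row vector [x] is in it exactly when [x_t = - x_s] along
    every edge [st]; by connectedness, such a vector is zero as soon as one
    entry is. If [x] is nonzero, its signs therefore 2-colour the graph, so in
    the non-bipartite case the kernel is trivial, [C] has rank [n], and every
    [1 + lambda_i] is positive ([rank_copies_nonbipartite],
    [row_free_eigval_gt0]). In the bipartite case the kernel is spanned by the
    [1, -1] vector of a 2-colouring, [C] has rank [n - 1], and [-1] is an
    eigenvalue of [P] attained by [lambda_n] alone ([corank_copies_bipartite],
    [corank1_eigval]). The rank of [C] also gives the dimension of its kernel,
    and the bounds [n <= m q] and [n - 1 <= m q] under which the truncated
    subtractions of the statement are exact. *)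

(** * Orthonormal families of eigenvectors *)

Lemma normsq_gt0 (R : rcfType) N (x : 'cV[R]_N) :
  x != 0 -> 0 < (x^T *m x) 0 0.
Proof.
move=> x_neq0; have ge0 i : true -> 0 <= x^T 0 i * x i 0.
  by rewrite mxE -expr2 sqr_ge0.
rewrite lt0r mxE sumr_ge0 // andbT psumr_neq0 //.
have /cV0Pn[i xi] := x_neq0; apply/hasP; exists i; rewrite ?mem_index_enum //=.
by rewrite mxE -expr2 exprn_even_gt0.
Qed.

Lemma orthonormal_ext (R : rcfType) (I : eqType) N (w w' : I -> 'cV[R]_N) :
  w =1 w' -> orthonormal w -> orthonormal w'.
Proof. by move=> eq_w ow x y; rewrite -!eq_w. Qed.

Lemma orthonormal_eigensystem_ext (R : rcfType) (I : finType) N (M : 'M[R]_N)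
    (mu mu' : I -> R) (w w' : I -> 'cV[R]_N) :
  mu =1 mu' -> w =1 w' ->
  orthonormal_eigensystem M mu w -> orthonormal_eigensystem M mu' w'.
Proof.
move=> eq_mu eq_w [chM eigM ow]; split; last exact: orthonormal_ext ow.
  by rewrite chM; apply: eq_bigr => x _; rewrite eq_mu.
by move=> x; rewrite -eq_w -eq_mu.
Qed.

(** The members of the family are the rows, so that orthonormality reads
    [F *m F^T = 1%:M]. *)
Definition frame_mx (R : rcfType) (I : finType) N (w : I -> 'cV[R]_N) :
    'M[R]_(#|I|, N) :=
  \matrix_(j, i) w (enum_val j) i 0.

Lemma frame_mulmx_tr (R : rcfType) (I : finType) N (w : I -> 'cV[R]_N) :
  orthonormal w -> frame_mx w *m (frame_mx w)^T = 1%:M.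
Proof.
move=> ow; apply/matrixP => j k; rewrite mxE [RHS]mxE.
have := ow (enum_val j) (enum_val k); rewrite (inj_eq enum_val_inj) => <-.
by rewrite mxE; apply: eq_bigr => i _; rewrite !mxE.
Qed.

(** An orthonormal family of [N] eigenvectors is a basis that diagonalises [M],
    so the characteristic polynomial comes for free once the eigenvectors are
    known: no multiplicity has to be computed separately. *)
Lemma char_poly_orthonormal (R : rcfType) (I : finType) N (M : 'M[R]_N)
    (mu : I -> R) (w : I -> 'cV[R]_N) :
  #|I| = N -> (forall x, M *m w x = mu x *: w x) -> orthonormal w ->
  char_poly M = \prod_x ('X - (mu x)%:P).
Proof.
move=> cardI; move: M w; case: N / cardI => M w eigM ow.
have WWt := frame_mulmx_tr ow.
pose W := map_mx polyC (frame_mx w); pose d := \row_j mu (@enum_val I I j).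
(* The vectors are the rows of [frame_mx w], so it is [M^T] that the frame
   conjugates to a diagonal matrix. *)
have MW : frame_mx w *m M^T = diag_mx d *m frame_mx w.
  apply/matrixP => j i; rewrite mul_diag_mx !mxE.
  have /matrixP/(_ i 0) := eigM (enum_val j); rewrite !mxE => <-.
  by apply: eq_bigr => k _; rewrite !mxE mulrC.
have tr_char : (char_poly_mx M)^T = 'X%:M - map_mx polyC M^T.
  by rewrite /char_poly_mx linearB /= tr_scalar_mx map_trmx.
have conjW : W *m (char_poly_mx M)^T *m W^T = char_poly_mx (diag_mx d).
  have WWt1 : W *m W^T = 1%:M by rewrite map_trmx -map_mxM WWt map_mx1.
  rewrite tr_char mulmxBr mulmxBl -(map_mxM _ (frame_mx w)) MW map_mxM /=.
  rewrite -/W -(mulmxA _ W) WWt1 mulmx1.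
  by rewrite mul_mx_scalar -scalemxAl WWt1 scalemx1.
have /(congr1 determinant) := conjW.
rewrite !det_mulmx !det_tr mulrC mulrA -expr2 => detE.
have detW : \det W ^+ 2 = 1.
  by rewrite expr2 -{2}det_tr -det_mulmx map_trmx -map_mxM WWt map_mx1 det1.
move: detE; rewrite detW mul1r -!/(char_poly _) => ->.
rewrite char_poly_trig ?diag_mx_is_trig //.
by rewrite [RHS]big_enum_val; apply: eq_bigr => j _; rewrite !mxE eqxx.
Qed.

Lemma mup_prod_XsubC (F : fieldType) (I : finType) (mu : I -> F) a :
  mup a (\prod_x ('X - (mu x)%:P)) = #|[set x | mu x == a]|.
Proof.
rewrite cardsE -sum1_card [RHS]big_mkcond /=.
suff [] : \prod_x ('X - (mu x)%:P) != 0 /\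
    mup a (\prod_x ('X - (mu x)%:P)) =
      (\sum_x (if mu x == a then 1 else 0))%N by [].
elim/big_rec2: _ => [|x k p _ [p_neq0 mup_p]].
  by rewrite oner_neq0 mupNroot // root1.
rewrite mulf_neq0 ?polyXsubC_eq0 // mupM ?polyXsubC_eq0 // mup_p.
by rewrite -['X - _]expr1 mup_XsubCX.
Qed.

(** * Orthonormal bases of kernels *)

Lemma orthonormal_rank (R : rcfType) N k (Y : 'I_k -> 'cV[R]_N) :
  orthonormal Y -> \rank (\matrix_(z, i) Y z i 0) = k.
Proof.
move=> oY; apply/eqP; rewrite eqn_leq rank_leq_row /=.
set F := \matrix_(z, i) _; have FFt : F *m F^T = 1%:M.
  apply/matrixP => z z'; rewrite mxE [RHS]mxE -oY mxE.
  by apply: eq_bigr => i _; rewrite !mxE.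
by have := mxrankM_maxl F F^T; rewrite FFt mxrank1.
Qed.

(** Gram-Schmidt, one vector at a time: as long as [k < N - \rank A], the
    matrix [A] stacked on the [k] vectors already found still has rank below
    [N], hence kills a nonzero vector; normalise it. *)
Lemma orthonormal_kernel_family (R : rcfType) p N (A : 'M[R]_(p, N)) k :
  (k <= N - \rank A)%N ->
  exists Y : 'I_k -> 'cV[R]_N, orthonormal Y /\ forall z, A *m Y z = 0.
Proof.
elim: k => [_|k IHk ltk].
  by exists (fun _ => 0); split=> [[]|[]].
have [Y [oY AY]] := IHk (ltnW ltk).
pose F : 'M_(k, N) := \matrix_(z, i) Y z i 0; pose S := col_mx A F.
have [x x_neq0 Sx] : exists2 x : 'cV_N, x != 0 & S *m x = 0.
  have : kermx S^T != 0.
    rewrite -mxrank_eq0 mxrank_ker mxrank_tr subn_eq0 -ltnNge.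
    have lt_rk : (\rank A + k < N)%N by rewrite -ltn_subRL.
    apply: leq_ltn_trans lt_rk.
    have := (mxrank_adds_leqif A F).1; rewrite (addsmxE A F) => rS.
    by apply: leq_trans rS _; rewrite leq_add2l rank_leq_row.
  case/rowV0Pn => y /sub_kermxP yS y_neq0; exists y^T; rewrite ?trmx_eq0 //.
  by apply: trmx_inj; rewrite trmx_mul trmxK yS trmx0.
have [Ax Fx] : A *m x = 0 /\ F *m x = 0.
  by move/eqP: Sx; rewrite mul_col_mx col_mx_eq0 => /andP[/eqP ? /eqP ?].
have Yx z : ((Y z)^T *m x) 0 0 = 0.
  have /matrixP/(_ z 0) := Fx; rewrite [RHS]mxE; apply: etrans.
  by rewrite !mxE; apply: eq_bigr => i _; rewrite !mxE.
have xY z : (x^T *m Y z) 0 0 = 0.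
  by rewrite -[_ *m _]trmxK trmx_mul trmxK mxE Yx.
set s := (x^T *m x) 0 0; have s_gt0 : 0 < s := normsq_gt0 x_neq0.
pose x1 := (Num.sqrt s)^-1 *: x.
exists (fun z => if unlift ord0 z is Some z' then Y z' else x1); split.
  move=> z z'; case: (unliftP ord0 z) => [y ->|->];
    case: (unliftP ord0 z') => [y' ->|->].
  - by rewrite oY (inj_eq lift_inj).
  - by rewrite -scalemxAr mxE Yx mulr0 eq_sym (negbTE (neq_lift _ _)).
  - by rewrite linearZ -scalemxAl mxE xY mulr0 (negbTE (neq_lift _ _)).
  rewrite [(_ *: x)^T]linearZ /= -scalemxAl -scalemxAr scalerA mxE -/s -expr2.
  by rewrite exprVn sqr_sqrtr ?ltW // mulVf // gt_eqF.
move=> z; case: (unliftP ord0 z) => [y|] _; rewrite ?AY //.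
by rewrite -scalemxAr Ax scaler0.
Qed.

(** An orthonormal family of [N - \rank A] vectors in the kernel spans it, by
    equality of dimensions. *)
Lemma orthonormal_kernel_basis_exists (R : rcfType) p N (A : 'M[R]_(p, N)) k :
  k = (N - \rank A)%N ->
  exists Y : 'I_k -> 'cV[R]_N, orthonormal_kernel_basis A Y.
Proof.
move=> kE; have [|Y [oY AY]] := @orthonormal_kernel_family _ _ _ A k.
  by rewrite kE.
exists Y; split=> // y; split=> [Ay|[a ->]]; last first.
  rewrite mulmx_sumr big1 // => z _.
  by rewrite -scalemxAr AY scaler0.
pose F : 'M_(k, N) := \matrix_(z, i) Y z i 0.
have subF : (F <= kermx A^T)%MS.
  apply/row_subP => z; apply/sub_kermxP.
  have -> : row z F = (Y z)^T by apply/rowP => i; rewrite !mxE.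
  by rewrite -trmx_mul AY trmx0.
(* [kermx A^T] is the kernel of [A] written as a space of row vectors. *)
have kerF : (kermx A^T <= F)%MS.
  rewrite -(mxrank_leqif_sup subF) orthonormal_rank //.
  by rewrite mxrank_ker mxrank_tr kE.
have /submxP[a ya] : (y^T <= F)%MS.
  by apply: submx_trans kerF; apply/sub_kermxP; rewrite -trmx_mul Ay trmx0.
exists (fun z => a 0 z); apply/matrixP => i j; rewrite ord1 -[y]trmxK ya !mxE.
by rewrite summxE; apply: eq_bigr => z _; rewrite !mxE.
Qed.

(** * The symmetric dilation of a rectangular matrix *)

Definition dilation_mx (R : rcfType) n N (E : 'M[R]_(n, N)) : 'M[R]_(n + N) :=
  block_mx 0 E E^T 0.

(** [u] is a left singular vector of [E], and [E^T *m u] its right partner, of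
    squared norm [(1 + l) / 2] when [u] has norm 1; the coefficients give the
    two blocks the same norm, hence total norm 1. *)
Definition dilation_eigvec (R : rcfType) n N (E : 'M[R]_(n, N)) (l : R)
    (u : 'cV[R]_n) (b : bool) : 'cV[R]_(n + N) :=
  col_mx ((Num.sqrt 2%:R)^-1 *: u)
    (((-1) ^+ b * (Num.sqrt (1 + l))^-1) *: (E^T *m u)).

(** The squared singular values of [E] are the numbers [(1 + l) / 2], and its
    left singular vectors are the eigenvectors of [P]. *)
Lemma half_plus_eigen (R : rcfType) n N (E : 'M[R]_(n, N)) (P : 'M[R]_n) l
    (u : 'cV[R]_n) :
  E *m E^T = 2%:R^-1 *: (1%:M + P) -> P *m u = l *: u ->
  E *m (E^T *m u) = ((1 + l) / 2%:R) *: u.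
Proof.
move=> EE Pu; rewrite mulmxA EE -scalemxAl mulmxDl mul1mx Pu.
by rewrite -{1}[u]scale1r -scalerDl scalerA mulrC.
Qed.

Lemma dilation_eigvecP (R : rcfType) n N (E : 'M[R]_(n, N)) (P : 'M[R]_n)
    l (u : 'cV[R]_n) b :
  E *m E^T = 2%:R^-1 *: (1%:M + P) -> P *m u = l *: u -> 0 < 1 + l ->
  dilation_mx E *m dilation_eigvec E l u b =
    subdiv_eigval l b *: dilation_eigvec E l u b.
Proof.
move=> EE Pu l_gt0; rewrite /dilation_mx mul_block_col !mul0mx add0r addr0.
rewrite -!scalemxAr (half_plus_eigen EE Pu) scale_col_mx !scalerA.
have s2 : Num.sqrt 2%:R != 0 :> R by rewrite sqrtr_eq0 -ltNge ltr0n.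
have sl : Num.sqrt (1 + l) != 0 by rewrite sqrtr_eq0 -ltNge.
have s2E : Num.sqrt 2%:R ^+ 2 = 2%:R :> R by rewrite sqr_sqrtr ?ler0n.
have slE : Num.sqrt (1 + l) ^+ 2 = 1 + l by rewrite sqr_sqrtr ?ltW.
rewrite /subdiv_eigval sqrtrM ?ltW // sqrtrV ?ler0n //.
move: sl s2 slE s2E; set r := Num.sqrt (1 + l); set t := Num.sqrt _.
move=> r_neq0 t_neq0 rE tE; congr (col_mx (_ *: _) (_ *: _)).
  by rewrite -rE -tE; field; rewrite t_neq0.
by case: b; rewrite /= ?expr0 ?expr1; field; rewrite r_neq0 t_neq0.
Qed.

(** Each singular pair [(u j, E^T *m u j)] with nonzero singular value yields
    two eigenvectors, and the null vectors [w0] must account for all remaining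
    dimensions. Writing [w0 k] as [col_mx a b], the second half is orthogonal to
    every [E^T *m u j] because [E *m b = 0]; only the first half needs the
    orthogonality hypothesis. *)
Lemma dilation_eigensystem (R : rcfType) n N (E : 'M[R]_(n, N)) (P : 'M[R]_n)
    (J K : finType) (l : J -> R) (u : J -> 'cV[R]_n)
    (w0 : K -> 'cV[R]_(n + N)) :
  E *m E^T = 2%:R^-1 *: (1%:M + P) ->
  (forall j, P *m u j = l j *: u j) -> orthonormal u ->
  (forall j, 0 < 1 + l j) ->
  orthonormal w0 -> (forall k, dilation_mx E *m w0 k = 0) ->
  (forall j k, (u j)^T *m usubmx (w0 k) = 0) ->
  (#|J| * 2 + #|K| = n + N)%N ->
  orthonormal_eigensystem (dilation_mx E)
    (fun x : (J * bool) + K =>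
       match x with inl (j, b) => subdiv_eigval (l j) b | inr _ => 0 end)
    (fun x : (J * bool) + K =>
       match x with
       | inl (j, b) => dilation_eigvec E (l j) (u j) b
       | inr k => w0 k
       end).
Proof.
move=> EE Pu ou l_gt0 ow0 Ew0 uw0 cardJK.
set mu := (X in orthonormal_eigensystem _ X _).
set w := (X in orthonormal_eigensystem _ _ X).
have eigw x : dilation_mx E *m w x = mu x *: w x.
  case: x => [[j b]|k] /=; first exact: (dilation_eigvecP b EE).
  by rewrite Ew0 scale0r.
have uE j : (E^T *m u j)^T = (u j)^T *m E by rewrite trmx_mul trmxK.
have cross j b k : (dilation_eigvec E (l j) (u j) b)^T *m w0 k = 0.
  have Ek : E *m dsubmx (w0 k) = 0.
    have /(congr1 usubmx) := Ew0 k.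
    by rewrite -{1}[w0 k]vsubmxK mul_block_col col_mxKu mul0mx add0r linear0.
  rewrite -[w0 k]vsubmxK tr_col_mx mul_row_col !linearZ /= -!scalemxAl uE.
  by rewrite -mulmxA Ek mulmx0 uw0 !scaler0 addr0.
have ow : orthonormal w.
  case=> [[i b]|k]; case=> [[j b']|k'] /=; last exact: ow0.
  - rewrite tr_col_mx mul_row_col ![(_ *: _)^T]linearZ /= -!scalemxAl uE.
    rewrite -!scalemxAr -mulmxA (half_plus_eigen EE (Pu j)) -scalemxAr !scalerA.
    rewrite mxE [X in X + _]mxE [X in _ + X]mxE ou.
    have -> : (inl (i, b) == inl (j, b') :> (J * bool) + K) =
        (i == j) && (b == b') by [].
    case: eqVneq => [->|_]; last by rewrite !mulr0 addr0.
    have s2E : Num.sqrt 2%:R ^+ 2 = 2%:R :> R by rewrite sqr_sqrtr ?ler0n.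
    have slE : Num.sqrt (1 + l j) ^+ 2 = 1 + l j by rewrite sqr_sqrtr ?ltW.
    have : Num.sqrt (1 + l j) != 0 by rewrite sqrtr_eq0 -ltNge.
    have : Num.sqrt 2%:R != 0 :> R by rewrite sqrtr_eq0 -ltNge ltr0n.
    move: slE s2E; set r := Num.sqrt (1 + l j); set t := Num.sqrt _.
    rewrite !mulr1 => <- tE t_neq0 r_neq0; rewrite -invfM -expr2 tE.
    by case: b; case: b'; rewrite /= ?expr0 ?expr1; field.
  - by rewrite cross mxE.
  by rewrite -[_ *m _]trmxK trmx_mul trmxK cross trmx0 mxE.
split=> //; apply: char_poly_orthonormal => //.
by rewrite card_sum card_prod card_bool.
Qed.

(** Since [0 < 1 + l j], the zeros of the spectrum are exactly the entries
    indexed by [K]. *)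
Lemma eigen_mult_dilation0 (R : rcfType) N (M : 'M[R]_N) (J K : finType)
    (l : J -> R) (w : (J * bool) + K -> 'cV[R]_N) :
  (forall j, 0 < 1 + l j) ->
  orthonormal_eigensystem M
    (fun x : (J * bool) + K =>
       match x with inl (j, b) => subdiv_eigval (l j) b | inr _ => 0 end) w ->
  eigen_mult M 0 = #|K|.
Proof.
move=> l_gt0 [chM _ _]; rewrite /eigen_mult chM mup_prod_XsubC.
rewrite -(card_imset K (@inr_inj (J * bool) K)); apply: eq_card => -[[j b]|k].
  rewrite inE mulf_eq0 signr_eq0 sqrtr_eq0 leNgt divr_gt0 ?ltr0n //=.
  by apply/esym/negP => /imsetP[].
by rewrite inE eqxx; apply/esym/imsetP; exists k.
Qed.

(** * The eigenvalue -1 and the left kernel of [E] *)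

(** The Rayleigh quotient of [1 + P = 2 E E^T] at [v i]. It gives the bound
    [-1 <= lam i], and shows that equality holds exactly when [E^T *m v i]
    vanishes. *)
Lemma one_plus_eigval (R : rcfType) n N (E : 'M[R]_(n, N)) (P : 'M[R]_n)
    (lam : 'I_n -> R) (v : 'I_n -> 'cV[R]_n) i :
  E *m E^T = 2%:R^-1 *: (1%:M + P) -> orthonormal_eigensystem P lam v ->
  1 + lam i = 2%:R * ((E^T *m v i)^T *m (E^T *m v i)) 0 0.
Proof.
move=> EE [_ Pv ov]; rewrite trmx_mul trmxK -mulmxA.
rewrite (half_plus_eigen EE (Pv i)) -scalemxAr mxE ov eqxx mulr1.
by rewrite mulrC divfK // pnatr_eq0.
Qed.

Lemma one_plus_eigval_ge0 (R : rcfType) n N (E : 'M[R]_(n, N)) (P : 'M[R]_n)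
    (lam : 'I_n -> R) (v : 'I_n -> 'cV[R]_n) i :
  E *m E^T = 2%:R^-1 *: (1%:M + P) -> orthonormal_eigensystem P lam v ->
  0 <= 1 + lam i.
Proof.
move=> EE Pv; rewrite (one_plus_eigval i EE Pv) mulr_ge0 ?ler0n //.
have [->|/normsq_gt0/ltW //] := eqVneq (E^T *m v i) 0.
by rewrite mulmx0 mxE.
Qed.

Lemma one_plus_eigval_gt0 (R : rcfType) n N (E : 'M[R]_(n, N)) (P : 'M[R]_n)
    (lam : 'I_n -> R) (v : 'I_n -> 'cV[R]_n) i :
  E *m E^T = 2%:R^-1 *: (1%:M + P) -> orthonormal_eigensystem P lam v ->
  E^T *m v i != 0 -> 0 < 1 + lam i.
Proof.
move=> EE Pv Ev; rewrite (one_plus_eigval i EE Pv) mulr_gt0 ?ltr0n //.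
exact: normsq_gt0.
Qed.

Lemma one_plus_eigval_eq0 (R : rcfType) n N (E : 'M[R]_(n, N)) (P : 'M[R]_n)
    (lam : 'I_n -> R) (v : 'I_n -> 'cV[R]_n) i :
  E *m E^T = 2%:R^-1 *: (1%:M + P) -> orthonormal_eigensystem P lam v ->
  1 + lam i = 0 -> E^T *m v i = 0.
Proof.
move=> EE Pv lam0; apply/eqP; apply: contra_eqT lam0 => Ev.
by rewrite gt_eqF // (one_plus_eigval_gt0 EE Pv Ev).
Qed.

Lemma orthonormal_neq0 (R : rcfType) (I : eqType) N (v : I -> 'cV[R]_N) i :
  orthonormal v -> v i != 0.
Proof.
move=> ov; apply/eqP => v0; have := ov i i.
by rewrite v0 mulmx0 mxE eqxx => /eqP; rewrite eq_sym oner_eq0.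
Qed.

Lemma row_free_eigval_gt0 (R : rcfType) n N (E : 'M[R]_(n, N)) (P : 'M[R]_n)
    (lam : 'I_n -> R) (v : 'I_n -> 'cV[R]_n) :
  E *m E^T = 2%:R^-1 *: (1%:M + P) -> orthonormal_eigensystem P lam v ->
  \rank E = n -> forall i, 0 < 1 + lam i.
Proof.
move=> EE Pv rE i; apply: (one_plus_eigval_gt0 EE Pv).
have [_ _ ov] := Pv; apply: contra (orthonormal_neq0 i ov) => /eqP Ev.
have kE0 : kermx E == 0 by rewrite -mxrank_eq0 mxrank_ker rE subnn.
rewrite -trmx_eq0 -submx0 -(eqP kE0); apply/sub_kermxP.
by rewrite -[_ *m _]trmxK trmx_mul trmxK Ev trmx0.
Qed.

(** A row vector [y] with [y *m E = 0] satisfies [y *m P = - y], so [-1] occurs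
    among the eigenvalues, and therefore at the least one. It occurs only once:
    two eigenvectors for [-1] lie in the one-dimensional left kernel of [E], so
    they are proportional and cannot be orthogonal. *)
Lemma corank1_eigval (R : rcfType) n N (E : 'M[R]_(n, N)) (P : 'M[R]_n)
    (lam : 'I_n -> R) (v : 'I_n -> 'cV[R]_n) (last : 'I_n) :
  E *m E^T = 2%:R^-1 *: (1%:M + P) -> orthonormal_eigensystem P lam v ->
  (forall i, lam last <= lam i) -> \rank (kermx E) = 1%N ->
  E^T *m v last = 0 /\ forall i, i != last -> 0 < 1 + lam i.
Proof.
move=> EE Pv lam_min rk; have [chP eigP ov] := Pv.
have [i lam_i] : exists i, 1 + lam i = 0.
  have : kermx E != 0 by rewrite -mxrank_eq0 rk.
  case/rowV0Pn => y /sub_kermxP yE y_neq0.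
  have : eigenvalue P (-1).
    apply/eigenvalueP; exists y => //; rewrite scaleN1r; apply/eqP.
    rewrite -addr_eq0 addrC -{1}[y]mulmx1 -mulmxDr.
    have -> : 1%:M + P = 2%:R *: (E *m E^T).
      by rewrite EE scalerA divff ?scale1r // pnatr_eq0.
    by rewrite -scalemxAr mulmxA yE mul0mx scaler0.
  rewrite eigenvalue_root_char chP /root horner_prod => /eqP/eqP.
  case/prodf_eq0 => i _; rewrite hornerXsubC => /eqP lam_i; exists i.
  by rewrite -[RHS]oppr0 -lam_i opprB opprK addrC.
have lam_last : 1 + lam last = 0.
  apply/eqP; rewrite eq_le (one_plus_eigval_ge0 last EE Pv) andbT.
  by rewrite -lam_i lerD2l.
have Ev_last := one_plus_eigval_eq0 EE Pv lam_last.
split=> // j j_last; apply: (one_plus_eigval_gt0 EE Pv).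
apply/eqP => Ev_j.
have kerv k : E^T *m v k = 0 -> ((v k)^T <= kermx E)%MS.
  move=> Ev; apply/sub_kermxP.
  by rewrite -[_ *m _]trmxK trmx_mul trmxK Ev trmx0.
have : (kermx E <= (v last)^T)%MS.
  rewrite -(mxrank_leqif_sup (kerv _ Ev_last)) rk rank_rV trmx_eq0.
  by rewrite orthonormal_neq0.
move/(submx_trans (kerv _ Ev_j))/sub_rVP => [a vj].
have := ov j last.
rewrite vj -scalemxAl mxE ov eqxx (negbTE j_last) mulr1 => a0.
by have := orthonormal_neq0 j ov; rewrite -trmx_eq0 vj a0 scale0r eqxx.
Qed.

(** * Counting incidences *)

Lemma sum_edge_index (V : nmodType) m q (F : 'I_m -> V) :
  \sum_(j < m * q) F (edge_index j) = (\sum_k F k) *+ q.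
Proof.
case: m F => [|m] F; first by rewrite !big_ord0 mul0rn.
pose f k := F (inord (k %% m.+1)).
have sumf p : \sum_(0 <= j < m.+1 * p) f j = (\sum_k F k) *+ p.
  elim: p => [|p IHp]; first by rewrite muln0 big_geq.
  rewrite (big_cat_nat _ (n := m.+1 * p)) ?leq_mul //= IHp mulrSr.
  congr (_ + _).
  rewrite -{1}[(m.+1 * p)%N]add0n big_addn -mulnBr subSnn muln1 big_mkord.
  apply: eq_bigr => k _; rewrite /f addnC mulnC modnMDl modn_small //.
  by rewrite inord_val.
rewrite -sumf big_mkord; apply: eq_bigr => j _; rewrite /f; congr F.
by apply: val_inj; rewrite /= inordK // ltn_mod.
Qed.

(** In a simple graph, [j |-> [set i; j]] is a bijection from the neighbours of
    [i] onto the edges at [i]. With [F] constant this counts the degree; with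
    [F e] the indicator of [i' \in e] it computes [B B^T]. *)
Lemma sum_incident_edges (V : nmodType) n m (G : sgraph n)
    (es : m.-tuple {set 'I_n}) i (F : {set 'I_n} -> V) :
  edge_enumeration G es ->
  \sum_(k < m | i \in tnth es k) F (tnth es k) =
    \sum_(j | G i j) F [set i; j].
Proof.
move=> [uniq_es es_edges].
rewrite -(big_tuple _ _ es (fun e => i \in e) F) -big_filter.
have -> : \sum_(j | G i j) F [set i; j] =
    \sum_(j in [set j | G i j]) F [set i; j].
  by apply: eq_bigl => j; rewrite inE.
rewrite -(big_imset F (h := fun j => [set i; j])) /=; last first.
  move=> j j'; rewrite !inE => Gij Gij' /setP/(_ j).
  rewrite !inE eqxx orbT; case: eqP => [ji|_ /esym/eqP //].
  by rewrite ji edge_irr in Gij.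
rewrite big_uniq ?filter_uniq //=; apply: eq_bigl => e.
rewrite mem_filter es_edges; apply/andP/imsetP => [[ie /imsetP[[s t]]]|[j]].
  rewrite inE /= => Gst eE; move: ie; rewrite eE !inE.
  case/orP=> /eqP->; [exists t | exists s]; rewrite ?inE //.
    by rewrite edge_sym.
  by rewrite setUC.
rewrite inE => Gij ->; rewrite !inE eqxx; split=> //.
by apply/imsetP; exists (i, j); rewrite ?inE.
Qed.

Lemma card_incident_edges n m (G : sgraph n) (es : m.-tuple {set 'I_n}) i :
  edge_enumeration G es -> (\sum_(k < m) (i \in tnth es k) = deg G i)%N.
Proof.
move=> es_edges; rewrite /deg cardsE -sum1_card.
apply: etrans (sum_incident_edges i (fun=> 1%N) es_edges).
by rewrite [RHS]big_mkcond; apply: eq_bigr => k _; case: (_ \in _).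
Qed.

Lemma edge_ends n m (G : sgraph n) (es : m.-tuple {set 'I_n}) k :
  edge_enumeration G es ->
  exists s t, [/\ s != t, G s t & tnth es k = [set s; t]].
Proof.
case=> _ es_edges; have := mem_tnth k es; rewrite es_edges.
case/imsetP=> -[s t]; rewrite inE /= => Gst ->; exists s, t; split=> //.
by apply: contraTneq Gst => ->; rewrite edge_irr.
Qed.

Lemma deg_subdivision_old n m q (G : sgraph n) (es : m.-tuple {set 'I_n}) i :
  edge_enumeration G es ->
  deg (subdivision es q) (lshift (m * q) i) = (q * deg G i)%N.
Proof.
move=> es_edges; rewrite -(card_incident_edges i es_edges) /deg cardsE.
rewrite -sum1_card big_mkcond big_split_ord /=.
rewrite big1 ?add0n => [|u _]; last first.
  by rewrite unfold_in /= /subdivision_rel !(unsplitK (inl _)).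
have := sum_edge_index q (fun k => (i \in tnth es k : nat)).
(* Multiples in the additive monoid [nat] are products. *)
have -> a : a *+ q = (q * a)%N by elim: q => // p IHp; rewrite mulrS IHp mulSn.
move=> <-; apply: eq_bigr => j _.
rewrite unfold_in /= /subdivision_rel (unsplitK (inl _)) (unsplitK (inr _)).
by case: (_ \in _).
Qed.

Lemma deg_subdivision_new n m q (G : sgraph n) (es : m.-tuple {set 'I_n}) j :
  edge_enumeration G es ->
  deg (subdivision es q) (rshift n j) = 2%N.
Proof.
move=> es_edges; rewrite /deg cardsE -sum1_card big_mkcond big_split_ord /=.
rewrite [X in (_ + X)%N]big1 ?addn0 => [|u _]; last first.
  by rewrite unfold_in /= /subdivision_rel !(unsplitK (inr _)).
have [s [t [st _ ek]]] := edge_ends (edge_index j) es_edges.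
have <- : #|[set s; t]| = 2%N by rewrite cards2 st.
rewrite -sum1_card [RHS]big_mkcond; apply: eq_bigr => i _.
rewrite unfold_in /= /subdivision_rel (unsplitK (inl _)) (unsplitK (inr _)).
by rewrite ek.
Qed.

(** * The normalized adjacency matrix of the subdivision graph *)

(** The off-diagonal block of the normalized adjacency matrix of the
    subdivision graph: old nodes have degree [q * deg G i], new ones degree 2,
    so the two normalizing factors combine to [1 / sqrt (2 q)] and [D^(-1/2)]. *)
Definition scaled_incidence_mx (R : rcfType) n m q (G : sgraph n)
    (es : m.-tuple {set 'I_n}) : 'M[R]_(n, m * q) :=
  (Num.sqrt (2%:R * q%:R))^-1 *:
    (deg_invsqrt_mx R G *m copies_mx q (incidence_mx R es)).

Lemma scaled_incidence_mxE (R : rcfType) n m q (G : sgraph n)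
    (es : m.-tuple {set 'I_n}) i (j : 'I_(m * q)) :
  scaled_incidence_mx R q G es i j =
    (i \in tnth es (edge_index j))%:R /
      (Num.sqrt (q * deg G i)%:R * Num.sqrt 2%:R).
Proof.
rewrite /scaled_incidence_mx /deg_invsqrt_mx mul_diag_mx !mxE.
rewrite natrM !sqrtrM ?ler0n // !invfM.
by ring.
Qed.

Lemma norm_adj_subdivision (R : rcfType) n m q (G : sgraph n)
    (es : m.-tuple {set 'I_n}) :
  edge_enumeration G es ->
  norm_adj_mx R (subdivision es q) = dilation_mx (scaled_incidence_mx R q G es).
Proof.
move=> es_edges; apply/matrixP => x y.
rewrite /norm_adj_mx /deg_invsqrt_mx mul_mx_diag mul_diag_mx !mxE /=.
rewrite /subdivision_rel.
case: (split_ordP x) => i ->; case: (split_ordP y) => j ->;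
  rewrite /dilation_mx ?col_mxEu ?col_mxEd ?row_mxEl ?row_mxEr.
- by rewrite mxE mulr0 mul0r.
- rewrite scaled_incidence_mxE !(deg_subdivision_old _ _ es_edges).
  rewrite !(deg_subdivision_new _ es_edges).
  by rewrite invfM; ring.
- rewrite mxE scaled_incidence_mxE !(deg_subdivision_old _ _ es_edges).
  rewrite !(deg_subdivision_new _ es_edges).
  by rewrite invfM; ring.
by rewrite mxE mulr0 mul0r.
Qed.

Lemma incidence_mul_tr (R : rcfType) n m (G : sgraph n)
    (es : m.-tuple {set 'I_n}) :
  edge_enumeration G es ->
  incidence_mx R es *m (incidence_mx R es)^T =
    diag_mx (\row_i (deg G i)%:R) + adj_mx R G.
Proof.
move=> es_edges; apply/matrixP => i i'; rewrite !mxE.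
have := sum_incident_edges i (fun e => (i' \in e)%:R : R) es_edges.
rewrite [LHS]big_mkcond => sumE.
transitivity (\sum_(j | G i j) (i' \in [set i; j])%:R : R).
  rewrite -sumE; apply: eq_bigr => k _; rewrite !mxE.
  by case: (i \in _); rewrite ?mul1r ?mul0r.
have [<-|ii'] := eqVneq i i'.
  rewrite edge_irr addr0 /deg cardsE -sum1_card natr_sum mulr1n.
  by apply: eq_bigr => j _; rewrite !inE eqxx.
rewrite mulr0n add0r big_mkcond (bigD1 i') //= big1 => [|j ji'].
  by rewrite !inE eqxx orbT addr0; case: (G i i').
by rewrite !inE eq_sym (negbTE ii') eq_sym (negbTE ji') if_same.
Qed.

Lemma copies_mul_tr (R : rcfType) n m q (B : 'M[R]_(n, m)) :
  copies_mx q B *m (copies_mx q B)^T = q%:R *: (B *m B^T).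
Proof.
apply/matrixP => i i'; rewrite !mxE mulr_natl -sum_edge_index.
by apply: eq_bigr => j _; rewrite !mxE.
Qed.

Lemma deg_gt0 n (G : sgraph n) i : (2 <= n)%N -> connected G -> (0 < deg G i)%N.
Proof.
move=> n_ge2 G_conn; rewrite card_gt0; apply/set0Pn.
have [j ij] : exists j, j != i.
  have : (0 < #|[set~ i]|)%N by rewrite cardsC1 card_ord; lia.
  by case/card_gt0P => j; rewrite !inE => ji; exists j.
case/connectP: (G_conn i j) => -[|k p] /=.
  by move=> _ /eqP; rewrite (negbTE ij).
by case/andP => Gik _ _; exists k; rewrite inE.
Qed.

(** [C C^T = q B B^T = q (D + A)], and conjugating by [D^(-1/2)] turns [D + A]
    into [1 + P]. *)
Lemma scaled_incidence_mul_tr (R : rcfType) n m q (G : sgraph n)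
    (es : m.-tuple {set 'I_n}) :
  (0 < q)%N -> (forall i, (0 < deg G i)%N) -> edge_enumeration G es ->
  let E := scaled_incidence_mx R q G es in
  E *m E^T = 2%:R^-1 *: (1%:M + norm_adj_mx R G).
Proof.
move=> q_gt0 d_gt0 es_edges /=; rewrite /scaled_incidence_mx.
set D := deg_invsqrt_mx R G; set C := copies_mx q _.
have Dt : D^T = D by rewrite /D /deg_invsqrt_mx tr_diag_mx.
rewrite [(_ *: _)^T]linearZ /= -scalemxAl -scalemxAr scalerA -expr2 exprVn.
rewrite sqr_sqrtr ?mulr_ge0 ?ler0n // trmx_mul Dt mulmxA -(mulmxA D).
rewrite copies_mul_tr (incidence_mul_tr _ es_edges) -scalemxAr -scalemxAl.
rewrite scalerA invfM mulrVK ?unitfE ?pnatr_eq0 -?lt0n // mulmxDr mulmxDl.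
congr (_ *: (_ + _)); rewrite /D /deg_invsqrt_mx; apply/matrixP => i j.
rewrite mul_mx_diag mul_diag_mx !mxE; case: eqVneq => [<-|_].
  rewrite !mulr1n mulrAC -invfM -expr2 sqr_sqrtr ?ler0n // mulVf //.
  by rewrite pnatr_eq0 -lt0n.
by rewrite !mulr0n mulr0 mul0r.
Qed.

(** * Bipartiteness and the rank of the incidence matrix *)

Lemma edge_index_surj m q (k : 'I_m) :
  (0 < q)%N -> exists j : 'I_(m * q), edge_index j = k.
Proof.
move=> q_gt0; have k_lt : (k < m * q)%N.
  by rewrite (leq_trans (ltn_ord k)) // leq_pmulr.
by exists (Ordinal k_lt); apply: val_inj; rewrite /= modn_small.
Qed.

(** The column of [C] at a copy of the edge [st] pairs with [x] to
    [x s + x t]. *)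
Lemma left_kernel_copies (R : rcfType) n m q (G : sgraph n)
    (es : m.-tuple {set 'I_n}) (x : 'rV[R]_n) :
  (0 < q)%N -> edge_enumeration G es ->
  x *m copies_mx q (incidence_mx R es) = 0 <->
  forall s t, G s t -> x 0 t = - x 0 s.
Proof.
move=> q_gt0 es_edges.
have colE j s t : s != t -> tnth es (edge_index j) = [set s; t] ->
    (x *m copies_mx q (incidence_mx R es)) 0 j = x 0 s + x 0 t.
  move=> st ej; rewrite mxE (bigD1 s) //= (bigD1 t) 1?eq_sym //= big1 => [|i].
    by rewrite !mxE ej !inE !eqxx orbT !mulr1 addr0.
  by case/andP => /negbTE i_s /negbTE i_t; rewrite !mxE ej !inE i_s i_t mulr0.
split=> [xC s t Gst|x_alt]; last first.
  apply/rowP => j.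
  have [s [t [st Gst ej]]] := edge_ends (edge_index j) es_edges.
  by rewrite (colE _ _ _ st ej) (x_alt s t Gst) subrr mxE.
have st : s != t by apply: contraTneq Gst => ->; rewrite edge_irr.
have : [set s; t] \in es.
  by rewrite es_edges.2; apply/imsetP; exists (s, t); rewrite ?inE.
case/tnthP => k ek; have [j jk] := edge_index_surj k q_gt0.
apply/eqP; rewrite -addr_eq0 addrC -(colE j) ?jk //.
by rewrite xC mxE.
Qed.

(** The zero set of an edge-alternating vector is closed under adjacency. *)
Lemma alternating_eq0 (R : rcfType) n (G : sgraph n) (x : 'rV[R]_n) i :
  connected G -> (forall s t, G s t -> x 0 t = - x 0 s) -> x 0 i = 0 -> x = 0.
Proof.
move=> G_conn x_alt xi; apply/rowP => j; rewrite mxE.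
have cl : closed G [pred k | x 0 k == 0].
  by move=> s t Gst; rewrite !inE (x_alt s t Gst) oppr_eq0.
by have := closed_connect cl (G_conn i j); rewrite !inE xi eqxx => /esym/eqP.
Qed.

(** A nonzero left null vector changes sign along every edge and vanishes
    nowhere, so its sign is a proper 2-colouring. *)
Lemma rank_copies_nonbipartite (R : rcfType) n m q (G : sgraph n)
    (es : m.-tuple {set 'I_n}) :
  (0 < q)%N -> connected G -> edge_enumeration G es -> ~ bipartite G ->
  \rank (copies_mx q (incidence_mx R es)) = n.
Proof.
move=> q_gt0 G_conn es_edges nbip; apply/eqP; rewrite -/(row_free _) -kermx_eq0.
apply/negPn/negP => /rowV0Pn[x /sub_kermxP xC x_neq0].
have x_alt := (left_kernel_copies x q_gt0 es_edges).1 xC.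
case: nbip; exists (fun i => 0 < x 0 i) => s t Gst.
have xs : x 0 s != 0.
  by apply: contra_neq x_neq0; apply: alternating_eq0 G_conn x_alt.
rewrite (x_alt s t Gst) oppr_gt0.
by case: ltrgtP xs.
Qed.

(** The [1, -1] vector of a 2-colouring is a left null vector; any other one,
    after subtracting the multiple of it that agrees at a chosen node, vanishes
    there and hence everywhere. *)
Lemma corank_copies_bipartite (R : rcfType) n m q (G : sgraph n)
    (es : m.-tuple {set 'I_n}) :
  (0 < q)%N -> (0 < n)%N -> connected G -> edge_enumeration G es ->
  bipartite G -> \rank (kermx (copies_mx q (incidence_mx R es))) = 1%N.
Proof.
move=> q_gt0 n_gt0 G_conn es_edges [c c_col]; set C := copies_mx q _.
pose i0 := Ordinal n_gt0.
have [f [f_alt f_i0]] : exists f : 'rV[R]_n,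
    (forall s t, G s t -> f 0 t = - f 0 s) /\ f 0 i0 != 0.
  exists (\row_i (-1) ^+ c i); split; last by rewrite mxE signr_eq0.
  move=> s t /c_col; rewrite !mxE; case: (c s); case: (c t) => //=.
  by rewrite opprK.
have f_neq0 : f != 0 by apply/rV0Pn; exists i0.
have fC : (f <= kermx C)%MS.
  by apply/sub_kermxP/(left_kernel_copies f q_gt0 es_edges).
have Cf : (kermx C <= f)%MS.
  apply/row_subP => i.
  have /sub_kermxP : (row i (kermx C) <= kermx C)%MS by apply: row_sub.
  move: (row i _) => x /(left_kernel_copies x q_gt0 es_edges) x_alt.
  apply/sub_rVP; exists (x 0 i0 / f 0 i0); apply/eqP; rewrite -subr_eq0.
  apply/eqP/(@alternating_eq0 _ _ G _ i0) => // [s t Gst|]; rewrite !mxE.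
    by rewrite (x_alt s t Gst) (f_alt s t Gst); ring.
  by rewrite divfK // subrr.
have <- : \rank f = 1%N by rewrite rank_rV f_neq0.
by apply/eqP; rewrite eqn_leq !mxrankS.
Qed.

Lemma scaled_incidence_rank (R : rcfType) n m q (G : sgraph n)
    (es : m.-tuple {set 'I_n}) :
  (0 < q)%N -> (forall i, (0 < deg G i)%N) ->
  \rank (scaled_incidence_mx R q G es) =
    \rank (copies_mx q (incidence_mx R es)).
Proof.
move=> q_gt0 d_gt0; rewrite eqmx_scale ?invr_eq0 ?sqrtr_eq0 -?ltNge; last first.
  by rewrite mulr_gt0 ?ltr0n.
rewrite eqmxMfull // row_full_unit unitmxE det_diag unitfE.
by apply/prodf_neq0 => i _; rewrite mxE invr_eq0 sqrtr_eq0 -ltNge ltr0n.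
Qed.

(** * The spectrum of the subdivision graph *)

Lemma subdiv_eigvecE (R : rcfType) n m q (G : sgraph n)
    (es : m.-tuple {set 'I_n}) (l : R) (u : 'cV[R]_n) b :
  0 < 1 + l ->
  subdiv_eigvec q G es l u b =
    dilation_eigvec (scaled_incidence_mx R q G es) l u b.
Proof.
move=> l_gt0; congr col_mx; apply/colP => j; rewrite !mxE.
rewrite sqrtrV ?mulr_ge0 ?ler0n ?ltW // sqrtrM ?mulr_ge0 ?ler0n // invfM.
rewrite [_^-1 * _^-1]mulrC mulrA -[LHS]mulrA; congr (_ * _).
rewrite big_mkcond mulr_sumr; apply: eq_bigr => s _.
rewrite mxE /scaled_incidence_mx /deg_invsqrt_mx mul_diag_mx !mxE /=.
rewrite /subdivision_rel (unsplitK (inl _)) (unsplitK (inr _)).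
by case: (_ \in _); rewrite /=; ring.
Qed.

Lemma orthonormal_old_new (R : rcfType) n N (I : eqType) (Y : I -> 'cV[R]_N) :
  orthonormal Y -> orthonormal (fun z => col_mx (0 : 'cV_n) (Y z)).
Proof.
by move=> oY z z'; rewrite tr_col_mx mul_row_col mulmx0 add0r oY.
Qed.

Theorem theorem4p4 (R : rcfType) (n m q : nat) (G : sgraph n)
    (es : m.-tuple {set 'I_n}) (lam : 'I_n -> R) (v : 'I_n -> 'cV[R]_n)
    (q_ge1 : (1 <= q)%N) (n_ge2 : (2 <= n)%N)
    (G_connected : connected G)
    (es_edges : edge_enumeration G es)
    (P_eigen : orthonormal_eigensystem (norm_adj_mx R G) lam v)
    (lam_sorted : forall i j : 'I_n, (i <= j)%N -> lam j <= lam i) :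
  let C := copies_mx q (incidence_mx R es) in
  let Phat := norm_adj_mx R (subdivision es q) in
  (~ bipartite G ->
    let k := (m * q - n)%N in
    [/\ eigen_mult Phat 0 = k,
        exists Y : 'I_k -> 'cV[R]_(m * q), orthonormal_kernel_basis C Y
      & forall Y : 'I_k -> 'cV[R]_(m * q),
          orthonormal_kernel_basis C Y ->
          orthonormal_eigensystem Phat
            (fun x : ('I_n * bool) + 'I_k =>
               match x with
               | inl (i, b) => subdiv_eigval (lam i) b
               | inr _ => 0
               end)
            (fun x : ('I_n * bool) + 'I_k =>
               match x with
               | inl (i, b) => subdiv_eigvec q G es (lam i) (v i) b
               | inr z => col_mx 0 (Y z)
               end)])
  /\
  (bipartite G ->
    (* mq - n may be -1 here, whence the order of the operations *)
    let k := (m * q + 1 - n)%N in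
    [/\ eigen_mult Phat 0 = (m * q + 2 - n)%N,
        exists Y : 'I_k -> 'cV[R]_(m * q), orthonormal_kernel_basis C Y
      & forall (last : 'I_n) (Y : 'I_k -> 'cV[R]_(m * q)),
          last = n.-1 :> nat ->
          orthonormal_kernel_basis C Y ->
          orthonormal_eigensystem Phat
            (fun x : ('I_n.-1 * bool) + option 'I_k =>
               match x with
               | inl (i, b) => subdiv_eigval (lam (widen_ord (leq_pred n) i)) b
               | inr _ => 0
               end)
            (fun x : ('I_n.-1 * bool) + option 'I_k =>
               match x with
               | inl (i, b) =>
                   let i' := widen_ord (leq_pred n) i in
                   subdiv_eigvec q G es (lam i') (v i') b
               | inr None => col_mx (v last) 0
               | inr (Some z) => col_mx 0 (Y z)
               end)]).
Proof.
move=> C Phat; pose E := scaled_incidence_mx R q G es.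
have d_gt0 i : (0 < deg G i)%N by apply: deg_gt0.
have PhatE : Phat = dilation_mx E by apply: norm_adj_subdivision.
have EE : E *m E^T = 2%:R^-1 *: (1%:M + norm_adj_mx R G).
  exact: scaled_incidence_mul_tr.
have rankE : \rank E = \rank C by apply: scaled_incidence_rank.
have EY (y : 'cV_(m * q)) : C *m y = 0 -> E *m y = 0.
  by move=> Cy; rewrite -scalemxAl -mulmxA Cy mulmx0 scaler0.
have basis_ker k (Y : 'I_k -> 'cV_(m * q)) z :
    orthonormal_kernel_basis C Y -> C *m Y z = 0.
  case=> _ kerY; apply/kerY; exists (fun z' => (z' == z)%:R).
  rewrite (bigD1 z) //= eqxx scale1r big1 ?addr0 // => z' /negbTE ->.
  by rewrite scale0r.
have new_ker k (Y : 'I_k -> 'cV_(m * q)) z :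
    orthonormal_kernel_basis C Y -> Phat *m col_mx 0 (Y z) = 0.
  move=> kerY; rewrite PhatE mul_block_col (EY _ (basis_ker _ _ z kerY)).
  by rewrite !mulmx0 mul0mx !addr0 col_mx0.
have [_ Pv ov] := P_eigen; split.
- move=> nbip k.
  have rC : \rank C = n by apply: rank_copies_nonbipartite.
  have lam_gt0 := row_free_eigval_gt0 EE P_eigen (etrans rankE rC).
  have n_le : (n <= m * q)%N by rewrite -rC rank_leq_col.
  have sys (Y : 'I_k -> 'cV[R]_(m * q)) : orthonormal_kernel_basis C Y ->
      orthonormal_eigensystem Phat
        (fun x : ('I_n * bool) + 'I_k =>
           match x with
           | inl (i, b) => subdiv_eigval (lam i) b
           | inr _ => 0
           end)
        (fun x : ('I_n * bool) + 'I_k =>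
           match x with
           | inl (i, b) => subdiv_eigvec q G es (lam i) (v i) b
           | inr z => col_mx 0 (Y z)
           end).
    move=> kerY; have := dilation_eigensystem EE Pv ov lam_gt0
      (orthonormal_old_new n kerY.1).
    rewrite -PhatE => sys; apply: orthonormal_eigensystem_ext (sys _ _ _) => //.
    - by case=> [[i b]|z] //; rewrite -subdiv_eigvecE.
    - by move=> z; apply: new_ker.
    - by move=> i z; rewrite col_mxKu mulmx0.
    by rewrite !card_ord /k; lia.
  have [Y kerY] :
      exists Y : 'I_k -> 'cV[R]_(m * q), orthonormal_kernel_basis C Y.
    by apply: orthonormal_kernel_basis_exists; rewrite rC.
  split; [|by exists Y | exact: sys].
  by rewrite (eigen_mult_dilation0 lam_gt0 (sys Y kerY)) card_ord.
move=> bip k; have n_gt0 : (0 < n)%N by apply: ltnW.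
have rkC : \rank (kermx C) = 1%N by apply: corank_copies_bipartite.
have rkE : \rank (kermx E) = 1%N by rewrite mxrank_ker rankE -mxrank_ker.
have rC : \rank C = n.-1 by move: rkC (rank_leq_row C); rewrite mxrank_ker; lia.
have n_le : (n.-1 <= m * q)%N by rewrite -rC rank_leq_col.
have last_lt : (n.-1 < n)%N by rewrite prednK.
pose last := Ordinal last_lt; pose wid i := widen_ord (leq_pred n) i.
have lam_min i : lam last <= lam i.
  by apply: lam_sorted; rewrite /= -ltnS prednK.
have [Ev_last lam_gt0] := corank1_eigval EE P_eigen lam_min rkE.
have wid_last i : wid i != last by rewrite -val_eqE /= ltn_eqF.
have wlam_gt0 i : 0 < 1 + lam (wid i) by apply: lam_gt0.
have ov_wid : orthonormal (v \o wid).
  have wid_inj : injective wid by move=> i j /(congr1 val) /= /val_inj.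
  by move=> i j; rewrite ov (inj_eq wid_inj).
have sys (Y : 'I_k -> 'cV[R]_(m * q)) : orthonormal_kernel_basis C Y ->
    orthonormal_eigensystem Phat
      (fun x : ('I_n.-1 * bool) + option 'I_k =>
         match x with
         | inl (i, b) => subdiv_eigval (lam (wid i)) b
         | inr _ => 0
         end)
      (fun x : ('I_n.-1 * bool) + option 'I_k =>
         match x with
         | inl (i, b) => subdiv_eigvec q G es (lam (wid i)) (v (wid i)) b
         | inr None => col_mx (v last) 0
         | inr (Some z) => col_mx 0 (Y z)
         end).
  move=> kerY; pose w0 (o : option 'I_k) : 'cV[R]_(n + m * q) :=
    if o is Some z then col_mx 0 (Y z) else col_mx (v last) 0.
  have ow0 : orthonormal w0.
    case=> [z|] [z'|]; rewrite /= tr_col_mx mul_row_col ?trmx0.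
    - by rewrite mul0mx add0r kerY.1.
    - by rewrite mul0mx mulmx0 addr0 mxE.
    - by rewrite mul0mx mulmx0 addr0 mxE.
    by rewrite mul0mx addr0 ov eqxx.
  have := dilation_eigensystem EE (fun i => Pv (wid i)) ov_wid wlam_gt0 ow0.
  rewrite -PhatE => sys; apply: orthonormal_eigensystem_ext (sys _ _ _) => //.
  - by case=> [[i b]|[z|]] //; rewrite -subdiv_eigvecE.
  - case=> [z|] /=; first exact: new_ker.
    by rewrite PhatE mul_block_col Ev_last mul0mx !mulmx0 !addr0 col_mx0.
  - move=> i [z|]; rewrite /= col_mxKu ?mulmx0 //.
    by apply/matrixP => a b; rewrite !ord1 ov (negbTE (wid_last i)) mxE.
  by rewrite card_option !card_ord /k; lia.
have [Y kerY] : exists Y : 'I_k -> 'cV[R]_(m * q), orthonormal_kernel_basis C Y.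
  by apply: orthonormal_kernel_basis_exists; rewrite rC /k; lia.
split; [|by exists Y |].
  rewrite (eigen_mult_dilation0 wlam_gt0 (sys Y kerY)) card_option card_ord.
  by rewrite /k; lia.
move=> last' {}Y last'E {}kerY; have -> : last' = last by apply: val_inj.
exact: sys.
Qed.
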